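(* For every integer $r\geq 4$ and every $\varepsilon>0$ there is a $K_{r-1}$-free graph $F$ such that $f_{F,K_r}(n)=\Omega(n^{1/2-\varepsilon})$ as $n\to\infty$.
   Context: All graphs are finite and simple. A graph is $F$-free if it does not contain $F$ as a (not necessarily induced) subgraph. For graphs $F,H$ and a positive integer $n$, $f_{F,H}(n)$ denotes the largest $m$ such that every $H$-free graph on $n$ vertices contains an $F$-free induced subgraph on $m$ vertices. $K_r$ is the complete graph on $r$ vertices. The constant implied by $\Omega(\cdot)$ may depend on $r,\varepsilon,F$ but not on $n$. *)

(* Defs.v *)
From mathcomp Require Import all_boot.
From mathcomp Require Import boolp.

Set Implicit Arguments.
Unset Strict Implicit.
Unset Printing Implicit Defensive.

Record sgraph := SGraph {
  vertex :> finType;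
  adj : rel vertex;
  adj_sym : symmetric adj;
  adj_irrefl : irreflexive adj }.

Section Complete.
Variable r : nat.

Definition complete_adj : rel 'I_r := fun i j => i != j.

Lemma complete_adj_sym : symmetric complete_adj.
Proof. by move=> i j; rewrite /complete_adj eq_sym. Qed.

Lemma complete_adj_irrefl : irreflexive complete_adj.
Proof. by move=> i; rewrite /complete_adj eqxx. Qed.

Definition complete_graph : sgraph := SGraph complete_adj_sym complete_adj_irrefl.

End Complete.

Section Induced.
Variables (G : sgraph) (S : {set G}).

Definition induced_adj : rel {x : G | x \in S} :=
  fun x y => adj (val x) (val y).

Lemma induced_adj_sym : symmetric induced_adj.
Proof. by move=> x y; exact: adj_sym. Qed.

Lemma induced_adj_irrefl : irreflexive induced_adj.
Proof. by move=> x; exact: adj_irrefl. Qed.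

Definition induced_graph : sgraph := SGraph induced_adj_sym induced_adj_irrefl.

End Induced.

(* [h] need not reflect adjacency: the copy of [F] in [G] is a subgraph that
   is not necessarily induced. *)
Definition contains_subgraph (G F : sgraph) : Prop :=
  exists h : F -> G,
    injective h /\ forall x y, adj x y -> adj (h x) (h y).

Definition subgraph_free (F G : sgraph) : Prop := ~ contains_subgraph G F.

Definition forces_free (F H : sgraph) (n m : nat) : Prop :=
  forall G : sgraph, #|G| = n -> subgraph_free H G ->
    exists S : {set G}, #|S| = m /\ subgraph_free F (induced_graph S).

(* The number f_{F,H}(n).  As soon as some H-free graph on n vertices exists,
   every m with [forces_free F H n m] satisfies m <= n, so bounding the range
   of the maximum loses nothing; if moreover F has a vertex, m = 0 is admissible
   and the maximum is attained.  If F has no vertex, no m is admissible and the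
   value is 0. *)
Definition erdos_rogers (F H : sgraph) (n : nat) : nat :=
  \max_(m < n.+1 | `[< forces_free F H n m >]) m.

Lemma erdos_rogers_forces (F H : sgraph) (n : nat) :
  (0 < #|F|)%N -> forces_free F H n (erdos_rogers F H n).
Proof.
move=> /card_gt0P[x _].
have h0 : `[< forces_free F H n (ord0 : 'I_n.+1) >].
  apply/asboolP => G _ _; exists set0; split; first by rewrite cards0.
  by move=> [h _]; case: (h x) => y; rewrite inE.
have : (0 < #|[pred m : 'I_n.+1 | `[< forces_free F H n m >]]|)%N.
  by apply/card_gt0P; exists ord0.
by rewrite /erdos_rogers; case/(eq_bigmax_cond (@nat_of_ord n.+1)) => m /asboolP hm ->.
Qed.

Lemma erdos_rogers_max (F H : sgraph) (n m : nat) :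
  (exists G : sgraph, #|G| = n /\ subgraph_free H G) ->
  forces_free F H n m -> (m <= erdos_rogers F H n)%N.
Proof.
move=> [G [Gn HG]] hm; have [S [Sm _]] := hm G Gn HG.
have lemn : (m < n.+1)%N by rewrite ltnS -Sm -Gn max_card.
apply: (@leq_bigmax_cond _ _ (fun i : 'I_n.+1 => nat_of_ord i) (Ordinal lemn)).
exact/asboolP.
Qed.

(* Main.v *)
(* Let [F] be the blow-up of K_{r-2} with large classes: it contains both
   K_{r-2} and K_{t,s}, so it suffices to find, in a K_r-free graph on n
   vertices, a set of n^(1/2-eps) vertices spanning no K_{r-2} or no K_{t,s}.
   Measure everything in powers of b = n^(1/(2k)), and call a vertex heavy for
   a set U if it is joined to at least a fraction 1/b of U.
   If some U with |U| >= n^(1/2) has more than n^(1/2) heavy vertices, either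
   two adjacent heavy vertices have a large common neighbourhood in U, which is
   K_{r-2}-free, or dependent random choice (the heavy vertices joined to all
   of a few random vertices of U) gives a large independent set.
   Otherwise, few t-tuples have at least n^(1/2) common neighbours, since all
   but k of their vertices are heavy for the common neighbourhood of the
   preceding ones.  A random set of density n^(-1/2-eps) then typically avoids
   all these t-tuples, and every other t-tuple typically has fewer than s common
   neighbours in it; deleting a vertex from each exception leaves no K_{t,s}. *)

Require Import Defs.
From mathcomp Require Import all_boot.
From mathcomp Require Import boolp zify.

Set Implicit Arguments.
Unset Strict Implicit.
Unset Printing Implicit Defensive.

(** * Neighbourhoods, cliques and bicliques *)

Definition nbh (G : sgraph) (w : G) : {set G} := [set x | adj w x].

Definition common_nbh (G : sgraph) (U : {set G}) (y : seq G) : {set G} :=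
  [set x in U | all (adj x) y].

(** [g] is automatically injective, since [adj] is irreflexive. *)
Definition has_clique (G : sgraph) (q : nat) (A : {set G}) : Prop :=
  exists g : 'I_q -> G,
    (forall i, g i \in A) /\ (forall i j, i != j -> adj (g i) (g j)).

Definition has_biclique (G : sgraph) (t s : nat) (A : {set G}) : Prop :=
  exists y x : seq G,
    [/\ size y = t /\ size x = s, uniq y /\ uniq x,
        {subset y <= A}, {subset x <= A} & {in x, forall u, all (adj u) y}].

Lemma has_cliqueS (G : sgraph) (q : nat) (A : {set G}) (w : G) :
  w \in A -> has_clique q (A :&: nbh w) -> has_clique q.+1 A.
Proof.
move=> wA [g [gA gadj]].
have gw i : adj w (g i) by have := gA i; rewrite !inE => /andP[].
exists (fun i => if unlift ord0 i is Some l then g l else w); split=> [i|i j].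
  by case: unliftP => [l _|_ //]; have := gA l; rewrite inE => /andP[].
case: unliftP => [k ->|->]; case: unliftP => [l ->|->] //.
- by rewrite (inj_eq (@lift_inj _ ord0)); exact: gadj.
- by rewrite adj_sym.
Qed.

Lemma has_clique_sub (G : sgraph) (q : nat) (A B : {set G}) :
  A \subset B -> has_clique q A -> has_clique q B.
Proof. by move=> /subsetP AB [g [gA ga]]; exists g; split=> // i; exact: AB. Qed.

Lemma subgraph_free_clique (G : sgraph) (r : nat) :
  subgraph_free (complete_graph r) G -> ~ has_clique r [set: G].
Proof.
move=> fr [g [_ ga]]; apply: fr; exists g; split=> // i j e.
by apply/eqP; apply: contraT => /ga; rewrite e adj_irrefl.
Qed.

(** * Counting tuples *)

Lemma card_tupleS (T : finType) (n : nat) (P : pred (seq T)) :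
  #|[set y : n.+1.-tuple T | P y]|
  = \sum_(w : T) #|[set y : n.-tuple T | P (w :: y)]|.
Proof.
under eq_bigr do rewrite -sum1_card.
rewrite pair_big_dep /= -sum1_card.
rewrite (reindex (fun p : T * n.-tuple T => [tuple of p.1 :: p.2])) /=.
  by apply: eq_bigl => -[w y]; rewrite !inE.
exists (fun y : n.+1.-tuple T => (thead y, [tuple of behead y])).
  by move=> [w y] _ /=; rewrite theadE; congr (_, _); exact/val_inj.
by move=> y _; rewrite /= -tuple_eta.
Qed.

Lemma card_tuple_all (T : finType) (n : nat) (A : {set T}) :
  #|[set y : n.-tuple T | all (mem A) y]| = #|A| ^ n.
Proof.
elim: n => [|n IH].
  rewrite expn0 -(expn0 #|T|) -card_tuple -cardsT; apply: eq_card => y.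
  by rewrite !inE tuple0.
rewrite card_tupleS (bigID (mem A)) /= addnC big1 => [|w /negPf wA].
  rewrite add0n (eq_bigr (fun=> #|A| ^ n)) ?sum_nat_const ?expnS // => w wA.
  by rewrite -IH; apply: eq_card => y; rewrite !inE wA.
by apply: eq_card0 => y; rewrite !inE wA.
Qed.

Lemma card_setE (T : finType) (P : pred T) :
  #|[set x | P x]| = \sum_(x : T) (P x : nat).
Proof. by rewrite -sum1_card big_mkcond; apply: eq_bigr => x _; rewrite inE; case: (P x). Qed.

Lemma leq_pow2r (m n e : nat) : m <= n -> m ^ e <= n ^ e.
Proof. by case: e => // e mn; rewrite leq_exp2r. Qed.

(** * Dependent random choice and the deletion method *)

(** Count pairs of some [w] in [W] and a [tau]-tuple [f] of its neighbours in [U]. For fixed [f],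
    the vertices of [W] joined to all of [f] and adjacent to no other such vertex are independent,
    hence at most [L]. Any other pair yields an adjacent [w'] with [f] inside the common
    neighbourhood of [w] and [w'], whence [M ^ tau]. *)
Lemma dependent_random_choice (G : sgraph) (U W : {set G}) (tau b M L : nat) :
  {in W, forall w, #|U| <= b * #|U :&: nbh w|} ->
  {in W &, forall w w', adj w w' -> #|U :&: nbh w :&: nbh w'| <= M} ->
  (forall I : {set G}, I \subset W -> {in I &, forall w w', ~~ adj w w'} ->
     #|I| <= L) ->
  #|W| * #|U| ^ tau <= b ^ tau * (L * #|U| ^ tau + #|W| ^ 2 * M ^ tau).
Proof.
move=> degW codegW indW.
pose I (f : tau.-tuple G) := [set w in W | all (adj w) f &
  [forall w' in W, adj w w' ==> ~~ all (adj w') f]].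
have leI f : #|I f| <= L.
  apply: indW => [|w w']; first by apply/subsetP=> w; rewrite inE => /andP[].
  rewrite !inE => /and3P[wW wf /forall_inP wI] /and3P[w'W w'f _].
  by apply/negP => ww'; have := wI _ w'W; rewrite ww' w'f.
pose c w w' (f : tau.-tuple G) : nat :=
  adj w w' && all (mem (U :&: nbh w :&: nbh w')) f.
have pointwise w (f : tau.-tuple G) : w \in W -> all (mem (U :&: nbh w)) f <=
    (all (mem U) f && (w \in I f)) + \sum_(w' in W) c w w' f.
  move=> wW; case: (boolP (all _ f)) => // /allP fUw.
  have -> : all (mem U) f by apply/allP => x /fUw; rewrite !inE => /andP[].
  have fw : all (adj w) f by apply/allP => x /fUw; rewrite !inE => /andP[].
  rewrite inE wW fw /=.
  have [_|] := boolP [forall w' in W, adj w w' ==> ~~ all (adj w') f].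
    exact: leq_addr.
  rewrite negb_forall_in => /exists_inP[w' w'W]; rewrite negb_imply negbK.
  move=> /andP[ww' /allP fw']; rewrite (bigD1 w') //= /c ww'.
  suff -> : all (mem (U :&: nbh w :&: nbh w')) f by rewrite addnA leq_addr.
  by apply/allP => x xf; have := fUw _ xf; rewrite !inE => -> /=; exact: fw'.
apply: (@leq_trans (b ^ tau * \sum_(w in W) #|U :&: nbh w| ^ tau)).
  rewrite -sum_nat_const big_distrr; apply: leq_sum => w wW /=.
  by rewrite -expnMn; exact/leq_pow2r/degW.
rewrite leq_mul2l; apply/orP; right.
apply: (@leq_trans (\sum_(w in W) \sum_(f : tau.-tuple G)
    ((all (mem U) f && (w \in I f)) + \sum_(w' in W) c w w' f))).
  apply: leq_sum => w wW; rewrite -card_tuple_all card_setE.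
  by apply: leq_sum => f _; exact: pointwise.
under eq_bigr do rewrite big_split /=.
rewrite big_split /= leq_add //.
  rewrite exchange_big /= mulnC -card_tuple_all card_setE big_distrl /=.
  apply: leq_sum => f _; case: (all _ _) => /=; last by rewrite big1.
  rewrite mul1n; apply: leq_trans (leI f); rewrite -sum1_card big_mkcond /=.
  rewrite [leqRHS]big_mkcond; apply: leq_sum => w _.
  by case: (w \in I f) => //; case: (w \in W).
rewrite -mulnn -mulnA -sum_nat_const; apply: leq_sum => w wW.
rewrite exchange_big /= -sum_nat_const; apply: leq_sum => w' w'W.
case: (boolP (adj w w')) => ww'; last by rewrite big1 // => f _; rewrite /c (negPf ww').
apply: leq_trans (leq_pow2r tau (codegW _ _ wW w'W ww')).
rewrite -card_tuple_all card_setE; apply: leq_sum => f _.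
by rewrite /c ww'.
Qed.

(** Deletion method: after division by [N ^ #|T|], the expected size of a random set of density
    [1 / N] is at most [#|S|] plus the expected number of sets [B i] inside it. *)
Lemma random_subset (T I : finType) (P : pred I) (B : I -> {set T}) (N : nat) :
  0 < N -> (forall i, P i -> B i != set0) ->
  exists S : {set T}, (forall i, P i -> ~~ (B i \subset S)) /\
    #|T| * N ^ #|T|.-1 <= #|S| * N ^ #|T| + \sum_(i | P i) N ^ (#|T| - #|B i|).
Proof.
move=> N0 Bn0.
pose good (S : {set T}) := [forall i, P i ==> ~~ (B i \subset S)].
have good0 : good set0.
  by apply/forallP => i; apply/implyP => /Bn0; rewrite subset0.
(* A largest good set is at least as large as what deletion leaves for any outcome [phi], so
   averaging over [phi] suffices. *)
case: (@arg_maxnP _ set0 good (fun S => #|S|) good0) => S gS maxS.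
exists S; split=> [i Pi|]; first by have /forallP/(_ i) := gS; rewrite Pi.
case: N N0 => // N _.
pose Z (phi : {ffun T -> 'I_N.+1}) := [set x | phi x == ord0].
have cardZ (A : {set T}) : \sum_(phi : {ffun T -> 'I_N.+1}) (A \subset Z phi : nat)
    = N.+1 ^ (#|T| - #|A|).
  pose F x : pred 'I_N.+1 := if x \in A then pred1 ord0 else predT.
  have -> : N.+1 ^ (#|T| - #|A|) = #|family F|.
    rewrite card_family foldrE big_map big_enum /= (bigID (mem A)) /=.
    rewrite big1 => [|x xA]; last by rewrite /F xA card1.
    rewrite mul1n (eq_bigr (fun=> N.+1)) => [|x /negPf xA]; last first.
      by rewrite /F xA card_ord.
    rewrite prod_nat_const -(cardsC A) addKn; congr (_ ^ _); apply: eq_card => x.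
    by rewrite !inE.
  rewrite -sum1_card [RHS]big_mkcond /=; apply: eq_bigr => phi _.
  suff -> : (phi \in family F) = (A \subset Z phi) by case: (_ \subset _).
  apply/familyP/subsetP => [h x xA|h x].
    by have := h x; rewrite /F xA !inE.
  by rewrite /F; case: ifP => // /h; rewrite !inE.
have alter phi : #|Z phi| <= #|S| + \sum_(i | P i) (B i \subset Z phi).
  pose s := [seq i <- enum P | B i \subset Z phi].
  (* One vertex from each [B i] inside [Z phi]; removing [X] makes the set good. *)
  pose X := [set x in pmap (fun i => [pick x in B i]) s].
  have cX : #|X| <= \sum_(i | P i) (B i \subset Z phi).
    rewrite cardsE (leq_trans (card_size _)) // size_pmap.
    rewrite (leq_trans (count_size _ _)) // size_filter -sum1_count big_mkcond.
    by rewrite big_enum /=.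
  apply: leq_trans (leq_add (maxS (Z phi :\: X) _) cX).
    by rewrite -(cardsID X (Z phi)) addnC leq_add2l subset_leq_card // subsetIr.
  apply/forallP => i; apply/implyP => Pi; apply/negP.
  rewrite subsetD => /andP[BZ /pred0P disj].
  have : exists2 x, x \in B i & [pick x in B i] = Some x.
    case: pickP => [x xB|Bi]; first by exists x.
    by have /set0Pn[x] := Bn0 _ Pi; rewrite Bi.
  case=> x xB xpick; have /negP[] := disj x; rewrite /= xB /= inE mem_pmap.
  rewrite -xpick; apply: map_f; rewrite mem_filter BZ.
  by rewrite mem_enum.
have : \sum_(phi : {ffun T -> 'I_N.+1}) #|Z phi| <=
    \sum_(phi : {ffun T -> 'I_N.+1})
      (#|S| + \sum_(i | P i) (B i \subset Z phi)).
  by apply: leq_sum => phi _; exact: alter.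
rewrite big_split /= sum_nat_const card_ffun card_ord.
rewrite [X in _ <= _ + X -> _]exchange_big /=.
under [X in _ <= _ + X -> _]eq_bigr do rewrite cardZ.
suff -> : \sum_(phi : {ffun T -> 'I_N.+1}) #|Z phi| = #|T| * N.+1 ^ #|T|.-1.
  by rewrite [_ * #|S|]mulnC.
under eq_bigr do rewrite card_setE.
rewrite exchange_big /= -sum_nat_const; apply: eq_bigr => x _.
rewrite -subn1 -(cards1 x) -cardZ; apply: eq_bigr => phi _.
by rewrite sub1set inE.
Qed.

(** * Tuples with a large common neighbourhood *)

Lemma common_nbh_cons (G : sgraph) (U : {set G}) (w : G) (y : seq G) :
  common_nbh U (w :: y) = common_nbh (U :&: nbh w) y.
Proof. by apply/setP => x; rewrite !inE /= -andbA (adj_sym w x). Qed.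

Lemma common_nbh_sub (G : sgraph) (U : {set G}) (y : seq G) :
  common_nbh U y \subset U.
Proof. by apply/subsetP => x; rewrite inE => /andP[]. Qed.

(* Along such a tuple at most [d] vertices cut the common neighbourhood by a
   factor [b] or more; all others are heavy, so have at most [b ^ k] choices. *)
Lemma card_rich_tuples (G : sgraph) (b k : nat) : 0 < b -> 0 < #|G| ->
  (forall U : {set G}, b ^ k <= #|U| ->
     #|[set w | #|U| <= b * #|U :&: nbh w| ]| <= b ^ k) ->
  forall (j d : nat) (U : {set G}), #|U| <= b ^ (k + d) ->
  #|[set y : j.-tuple G | b ^ k <= #|common_nbh U y| ]|
  <= 2 ^ j * (#|G| ^ d * b ^ (k * j)).
Proof.
move=> b0 G0 few; elim=> [|j IH] d U Ud.
  rewrite muln0 !muln1 mul1n (leq_trans (max_card _)) // card_tuple.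
  by rewrite expn_gt0 G0.
rewrite (card_tupleS _ (fun y => b ^ k <= #|common_nbh U y|)).
under eq_bigr do under eq_finset do rewrite common_nbh_cons.
have [Usmall|Ularge] := ltnP #|U| (b ^ k).
  rewrite big1 // => w _; apply: eq_card0 => y; rewrite !inE leqNgt.
  rewrite (leq_ltn_trans _ Usmall) // subset_leq_card //.
  exact: subset_trans (common_nbh_sub _ _) (subsetIl _ _).
pose W := [set w | #|U| <= b * #|U :&: nbh w| ].
rewrite (bigID (mem W)) /= expnS mul2n -addnn mulnDl leq_add //.
  apply: (@leq_trans (\sum_(w in W) 2 ^ j * (#|G| ^ d * b ^ (k * j)))).
    by apply: leq_sum => w _; apply: IH; rewrite (leq_trans _ Ud) // subset_leq_card // subsetIl.
  rewrite sum_nat_const mulnCA leq_mul2l mulnCA leq_mul2l mulnS expnD leq_mul2r.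
  by rewrite few ?orbT.
(* If [d = 0], then [#|U| <= b ^ k], and a light vertex leaves fewer than [b ^ k] common
   neighbours. *)
case: d Ud => [|d] Ud.
  rewrite big1 // => w; rewrite inE -ltnNge => wW; apply: eq_card0 => y.
  rewrite !inE; apply/negbTE; rewrite -ltnNge.
  apply: leq_ltn_trans (subset_leq_card (common_nbh_sub _ _)) _.
  rewrite addn0 in Ud; apply: leq_trans Ud; apply: leq_trans wW.
  by rewrite ltnS leq_pmull.
apply: (@leq_trans (\sum_(w | w \notin W) 2 ^ j * (#|G| ^ d * b ^ (k * j)))).
  apply: leq_sum => w; rewrite inE -ltnNge => wW.
  apply: IH; rewrite -(leq_pmul2l b0) -expnS -addnS.
  exact: leq_trans (ltnW wW) Ud.
rewrite sum_nat_const mulnCA leq_mul2l expnS -mulnA.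
rewrite leq_mul ?max_card ?orbT // leq_mul2l leq_pexp2l ?orbT //.
by rewrite leq_mul2l leqnSn orbT.
Qed.

(** * Large sets without a biclique *)

Lemma leq_mul_cancel (a c m n x M : nat) :
  0 < x -> a * x <= c * m -> M * c <= n * x -> M * a <= n * m.
Proof.
move=> x0 ac cn; rewrite -(leq_pmul2r x0) -mulnA.
apply: leq_trans (leq_mul (leqnn M) ac) _.
by rewrite mulnA [leqRHS]mulnAC leq_mul.
Qed.

(** Sample with density [1 / N]. The hypotheses bound by [#|G| / (4 * N)] the expected number of
    surviving rich tuples, and likewise of bicliques over poor tuples, so deletion leaves half of
    the expected [#|G| / N] vertices. *)
Lemma biclique_free_subset (G : sgraph) (t s N C : nat) :
  0 < t -> 0 < N ->
  4 * N * #|[set y : t.-tuple G | C <= #|common_nbh setT y|]|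
    <= #|G| * N ^ t ->
  4 * N * (#|G| ^ t * C ^ s) <= #|G| * N ^ (t + s) ->
  exists S : {set G}, ~ has_biclique t s S /\ #|G| <= 2 * N * #|S|.
Proof.
move=> t0 N0 rich poor.
have [G0|G0] := posnP #|G|.
  exists set0; rewrite G0; split=> // -[[|u y] [x [[/= st _] _ yS _ _]]].
    by rewrite -st in t0.
  by have := yS u; rewrite !inE eqxx => /(_ isT).
(* [inl] indexes rich tuples and [inr] bicliques over poor ones; distinctness gives [B i] exactly
   [t] or [t + s] elements. *)
pose I := (t.-tuple G + t.-tuple G * s.-tuple G)%type.
pose P (i : I) := match i with
  | inl y => uniq y && (C <= #|common_nbh setT y|)
  | inr (y, x) => [&& uniq (y ++ x), #|common_nbh setT y| <= C &
                   all (mem (common_nbh setT y)) x] end.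
pose B (i : I) : {set G} := match i with
  | inl y => [set z in val y] | inr (y, x) => [set z in val y ++ val x] end.
have B1 y : P (inl y) -> #|B (inl y)| = t.
  by move=> /andP[/card_uniqP Uy _]; rewrite cardsE Uy size_tuple.
have B2 y x : P (inr (y, x)) -> #|B (inr (y, x))| = t + s.
  by move=> /andP[/card_uniqP U _]; rewrite cardsE U size_cat !size_tuple.
have [|S [goodS]] := @random_subset G I P B N N0.
  move=> [y /B1|[y x] /B2] e; rewrite -card_gt0 e //.
  by rewrite addn_gt0 t0.
rewrite big_sumType /=; set A1 := \sum_(y | _) _; set A2 := \sum_(p | _) _.
move=> sizeS; exists S; split.
  move=> [y [x [[/eqP sy /eqP sx] [Uy Ux] yS xS xy]]].
  have xin u : u \in x -> u \in common_nbh setT y.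
    by move=> ux; rewrite !inE; exact: xy.
  have [rich_y|poor_y] := leqP C #|common_nbh setT y|.
    have := goodS (inl (Tuple sy)); rewrite /= Uy rich_y => /(_ isT) /negP; apply.
    by apply/subsetP => u; rewrite inE => /yS.
  have := goodS (inr (Tuple sy, Tuple sx)).
  rewrite /P cat_uniq Uy Ux (ltnW poor_y) andbT /=.
  have -> : ~~ has (in_mem^~ (mem y)) x.
    by apply/hasPn => u ux; apply/negP => /(allP (xy _ ux)); rewrite adj_irrefl.
  have -> /= : all (mem (common_nbh setT y)) x by apply/allP.
  move=> /(_ isT) /negP; apply; apply/subsetP => u; rewrite inE mem_cat.
  by case/orP=> [/yS|/xS].
have NG0 : 0 < N ^ #|G| by rewrite expn_gt0 N0.
have A1le : 4 * N * A1 <= #|G| * N ^ #|G|.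
  apply: leq_mul_cancel _ rich; first by rewrite expn_gt0 N0.
  rewrite -sum_nat_const big_distrl /= big_mkcond [leqRHS]big_mkcond /=.
  apply: leq_sum => y _; case: ifP => // Py.
  have := Py => /andP[_ ry]; rewrite inE ry.
  by rewrite (B1 _ Py) -expnD subnK // -(B1 _ Py) max_card.
have A2le : 4 * N * A2 <= #|G| * N ^ #|G|.
  apply: leq_mul_cancel _ poor; first by rewrite expn_gt0 N0.
  rewrite big_distrl /= big_mkcond /=.
  rewrite -card_tuple -sum_nat_const !big_distrl /=.
  apply: (@leq_trans (\sum_(y : t.-tuple G) \sum_(x : s.-tuple G)
      (if P (inr (y, x)) then N ^ #|G| else 0))).
    rewrite pair_big /=; apply: leq_sum => -[y x] _; case: ifP => // Pyx.
    by rewrite (B2 _ _ Pyx) -expnD subnK // -(B2 _ _ Pyx) max_card.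
  apply: leq_sum => y _; rewrite -big_mkcond sum_nat_const leq_mul2r.
  apply/orP; right; have [yC|yC] := leqP #|common_nbh setT y| C.
    rewrite (leq_trans _ (leq_pow2r s yC)) // -card_tuple_all subset_leq_card //.
    by apply/subsetP => x; rewrite inE => /and3P[].
  by rewrite (eq_card0 (A := _)) // => x; apply/negbTE/negP => /and3P[].
have loss (n m X a1 a2 : nat) : n * X <= N * (m * X + (a1 + a2)) ->
    4 * N * a1 <= n * X -> 4 * N * a2 <= n * X -> n * X <= 2 * N * m * X.
  by nia.
rewrite -(leq_pmul2r NG0); apply: (loss _ _ _ A1 A2) => //.
suff -> : #|G| * N ^ #|G| = N * (#|G| * N ^ #|G|.-1) by rewrite leq_pmul2l.
by rewrite mulnCA -expnS prednK.
Qed.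

(** * Sparse sets in graphs without large cliques *)

Lemma subset_of_card (T : finType) (A : {set T}) (m : nat) :
  m <= #|A| -> exists2 B : {set T}, B \subset A & #|B| = m.
Proof.
move=> mA; exists [set x in take m (enum A)].
  by apply/subsetP => x; rewrite inE => /mem_take; rewrite mem_enum.
rewrite cardsE (card_uniqP _) ?take_uniq ?enum_uniq //.
by rewrite size_take_min -cardE; apply/minn_idPl.
Qed.

(** Apply dependent random choice with [tau = a.-1] to [b ^ k] heavy vertices. A [K_q] in the common
    neighbourhood of two adjacent ones would give [K_(q+2)], and an independent set has no [K_q]; so
    both [M] and [L] can be [b ^ (k - a)]. *)
Lemma few_heavy_vertices (G : sgraph) (q k a b : nat) (U : {set G}) :
  1 < q -> 2 < b -> 0 < a <= k -> k < (a.-1) ^ 2 ->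
  subgraph_free (complete_graph q.+2) G ->
  (forall S : {set G}, b ^ (k - a) <= #|S| -> has_clique q S) ->
  b ^ k <= #|U| -> #|[set w | #|U| <= b * #|U :&: nbh w| ]| <= b ^ k.
Proof.
move=> q1 b2 /andP[a0 ak] ka Gfree allS Ularge.
rewrite leqNgt; apply/negP => /ltnW/subset_of_card[W /subsetP WU cardW].
have b0 : 0 < b by lia.
have : #|W| * #|U| ^ a.-1 <= b ^ a.-1 *
    (b ^ (k - a) * #|U| ^ a.-1 + #|W| ^ 2 * (b ^ (k - a)) ^ a.-1).
  apply: dependent_random_choice => [w /WU|w w' _ _ ww'|I _ Iind].
  - by rewrite inE.
  - rewrite leqNgt; apply/negP => /ltnW/allS cl.
    apply: (subgraph_free_clique Gfree).
    apply: (@has_cliqueS _ _ _ w) => //; apply: (@has_cliqueS _ _ _ w').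
      by rewrite !inE.
    apply: has_clique_sub cl; rewrite -setIA; apply/subsetP => x.
    by rewrite !inE => /andP[_].
  - rewrite leqNgt; apply/negP => /ltnW/allS[g [gI ga]].
    have := ga (Ordinal (ltnW q1)) (Ordinal q1) isT.
    by apply/negP/Iind; exact: gI.
rewrite cardW leqNgt => /negP; apply.
have u0 : 0 < #|U| ^ a.-1 by rewrite expn_gt0 (leq_trans _ Ularge) ?expn_gt0 ?b0.
apply: (@leq_ltn_trans (2 * (b ^ k.-1 * #|U| ^ a.-1))); last first.
  have -> : b ^ k = b * b ^ k.-1 by rewrite -expnS prednK // (leq_trans a0).
  rewrite -mulnA ltn_pmul2r //.
  by rewrite muln_gt0 u0 expn_gt0 b0.
rewrite mulnDr mul2n -addnn leq_add //.
  by rewrite mulnA -expnD leq_mul2r leq_pexp2l ?orbT //; lia.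
(* The exponents compare because [k < a.-1 ^ 2]. *)
apply: (@leq_trans (b ^ k.-1 * (b ^ k) ^ a.-1)).
  by rewrite -!expnM -!expnD leq_pexp2l //; nia.
by rewrite leq_mul2l leq_pow2r ?orbT.
Qed.

Lemma sparse_subset (G : sgraph) (q k a b t s : nat) :
  t = 2 * k ^ 2 + a -> s = a + k * t ->
  1 < q -> 3 < b -> 3 < a <= k -> k < (a.-1) ^ 2 ->
  subgraph_free (complete_graph q.+2) G ->
  b ^ (2 * k).-1 <= #|G| <= b ^ (2 * k) ->
  exists2 S : {set G}, b ^ (k - a) <= #|S| &
    ~ has_clique q S \/ ~ has_biclique t s S.
Proof.
move=> tE sE q1 b3 /andP[a3 ak] ka Gfree /andP[nlow nup].
apply: contrapT => noS.
have b0 : 0 < b by lia.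
have ak' : 0 < a <= k by rewrite ak (ltn_trans _ a3).
have G0 : 0 < #|G| by rewrite (leq_trans _ nlow) // expn_gt0 b0.
have allS (S : {set G}) : b ^ (k - a) <= #|S| -> has_clique q S.
  by move=> Slarge; apply: contrapT => Sfree; apply: noS; exists S => //; left.
have rich := @card_rich_tuples G b k b0 G0
  (fun U => @few_heavy_vertices G q k a b U q1 (ltnW b3) ak' ka Gfree allS).
have {}rich : #|[set y : t.-tuple G | b ^ k <= #|common_nbh setT y| ]|
    <= b ^ (t + 2 * k * k + k * t).
  apply: leq_trans (rich t k setT _) _.
    by rewrite cardsT addnn -mul2n.
  rewrite !expnD -(mulnA (b ^ t)); apply: leq_mul; first by apply: leq_pow2r; lia.
  by rewrite leq_mul2r [b ^ (2 * k * k)]expnM leq_pow2r ?orbT.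
(* With [N = b ^ (k + a - 2)], half of [#|G| / N] is at least [b ^ (k - a + 1) / 2], which exceeds
   [b ^ (k - a)]. *)
have [||||S [Sfree Slarge]] :=
  @biclique_free_subset G t s (b ^ (k + a - 2)) (b ^ k).
- by lia.
- by rewrite expn_gt0 b0.
- apply: (@leq_trans (b * b ^ (k + a - 2) * b ^ (t + 2 * k * k + k * t))).
    by rewrite !leq_mul.
  apply: (@leq_trans (b ^ (2 * k).-1 * (b ^ (k + a - 2)) ^ t)); last first.
    by rewrite leq_mul2r nlow orbT.
  rewrite -expnM -expnS -!expnD leq_pexp2l //.
  have -> : k + a - 2 = k + (a - 3) + 1 by lia.
  (* What remains is [a + 2 * k ^ 2 <= k + (a - 3) * t], which dictates the value of [t]. *)
  have := leq_pmull t (n := a - 3); rewrite !mulnDl subn_gt0 a3 => /(_ isT).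
  by lia.
- apply: (@leq_trans (b * b ^ (k + a - 2) * ((b ^ (2 * k)) ^ t * (b ^ k) ^ s))).
    by rewrite !leq_mul // leq_pow2r.
  apply: (@leq_trans (b ^ (2 * k).-1 * (b ^ (k + a - 2)) ^ (t + s))); last first.
    by rewrite leq_mul2r nlow orbT.
  rewrite -!expnM -expnS -!expnD leq_pexp2l //.
  have -> : k + a - 2 = k + (a - 3) + 1 by lia.
  (* What remains is [a + k * t <= k + (a - 2) * (t + s)], which dictates the value of [s]. *)
  have : a - 3 <= a by lia.
  rewrite !mulnDl !mulnDr; move: (a - 3) => e.
  move: (e * t) (e * s) (k * s) => et es ks; lia.
apply: noS; exists S; last by right.
rewrite leqNgt; apply/negP => Ssmall.
have : b ^ (2 * k).-1 < b * b ^ (2 * k).-2.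
  apply: leq_ltn_trans (leq_trans nlow Slarge) _.
  rewrite -mulnA.
  apply: (@leq_ltn_trans (2 * b ^ (2 * k).-2)); last first.
    by rewrite ltn_pmul2r ?expn_gt0 ?b0; lia.
  rewrite leq_mul2l /=; apply: (@leq_trans (b ^ (k + a - 2) * b ^ (k - a))).
    by rewrite leq_mul2l (ltnW Ssmall) orbT.
  by rewrite -expnD leq_pexp2l //; lia.
suff -> : b ^ (2 * k).-1 = b * b ^ (2 * k).-2 by rewrite ltnn.
by rewrite -expnS; congr (_ ^ _); lia.
Qed.

(** * The forbidden graph: a blow-up of [K_q] *)

Section Blowup.
Variables q s : nat.

Definition blowup_adj : rel ('I_q * 'I_s) := fun x y => x.1 != y.1.

Lemma blowup_adj_sym : symmetric blowup_adj.
Proof. by move=> x y; rewrite /blowup_adj eq_sym. Qed.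

Lemma blowup_adj_irrefl : irreflexive blowup_adj.
Proof. by move=> x; rewrite /blowup_adj eqxx. Qed.

Definition blowup : sgraph := SGraph blowup_adj_sym blowup_adj_irrefl.

Lemma blowup_clique_free : subgraph_free (complete_graph q.+1) blowup.
Proof.
move=> [h [_ hadj]].
have inj : injective (fun i => (h i).1).
  move=> i j ij; apply/eqP; apply: contraT => /hadj.
  by rewrite /= /blowup_adj ij eqxx.
by have := leq_card _ inj; rewrite !card_ord ltnn.
Qed.

(** One vertex from each class gives the clique; two classes, one cut down to [t] vertices, give the
    biclique. *)
Lemma contains_blowup (G : sgraph) (S : {set G}) (t : nat) : 1 < q -> t <= s ->
  0 < s -> contains_subgraph (induced_graph S) blowup ->
  has_clique q S /\ has_biclique t s S.
Proof.
move=> q1 ts s0 [h [hinj hadj]]; split.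
  exists (fun i => val (h (i, Ordinal s0))); split=> [i|i j ij].
    exact: valP.
  by have := hadj (i, Ordinal s0) (j, Ordinal s0) ij.
pose part i l : seq G := [seq val (h (i, j)) | j <- l].
have partS i l : {subset part i l <= S} by move=> _ /mapP[j _ ->]; exact: valP.
have part_inj i : injective (fun j => val (h (i, j))).
  by move=> j l /val_inj /hinj [].
exists (part (Ordinal (ltnW q1)) (take t (enum 'I_s))),
  (part (Ordinal q1) (enum 'I_s)); split=> //.
- by split; rewrite size_map ?size_take_min size_enum_ord ?(minn_idPl ts).
- by split; rewrite map_inj_uniq // ?take_uniq ?enum_uniq.
- move=> _ /mapP[j _ ->]; apply/allP => _ /mapP[j' _ ->].
  by have := hadj (Ordinal q1, j) (Ordinal (ltnW q1), j') isT.
Qed.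

End Blowup.

Lemma has_biclique_sub (G : sgraph) (t s : nat) (A B : {set G}) :
  A \subset B -> has_biclique t s A -> has_biclique t s B.
Proof.
move=> /subsetP AB [y [x [sz un yA xA xy]]]; exists y, x; split=> // u.
  by move/yA/AB.
by move/xA/AB.
Qed.

Lemma forces_blowup (q k a b t s n : nat) :
  t = 2 * k ^ 2 + a -> s = a + k * t ->
  1 < q -> 3 < b -> 3 < a <= k -> k < (a.-1) ^ 2 ->
  b ^ (2 * k).-1 <= n <= b ^ (2 * k) ->
  forces_free (blowup q s) (complete_graph q.+2) n (b ^ (k - a)).
Proof.
move=> tE sE q1 b3 ak ka nb G Gn Gfree; rewrite -Gn in nb.
have [S Slarge Sfree] := sparse_subset tE sE q1 b3 ak ka Gfree nb.
have [S' S'S S'card] := subset_of_card Slarge.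
exists S'; split=> // /(@contains_blowup _ _ _ _ t q1)[||cl bi].
- by nia.
- by lia.
by case: Sfree; apply; [exact: has_clique_sub cl|exact: has_biclique_sub bi].
Qed.

(** * Asymptotics and choice of parameters *)

Lemma clique_free_graph (n r : nat) : 1 < r ->
  exists G : sgraph, #|G| = n /\ subgraph_free (complete_graph r) G.
Proof.
move=> r1.
have sym : symmetric (fun _ _ : 'I_n => false) by [].
have irr : irreflexive (fun _ _ : 'I_n => false) by [].
exists (SGraph sym irr); split=> [|[h [_ hadj]]]; first by rewrite card_ord.
by have := hadj (Ordinal (ltnW r1)) (Ordinal r1) isT.
Qed.

(** For the least [b] with [n <= b ^ e], [b ^ e <= 2 ^ e * b.-1 ^ e <= b * n]. *)
Lemma between_powers (e B n : nat) : 0 < e -> 2 ^ e <= B -> B ^ e < n ->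
  exists2 b, B < b & b ^ e.-1 <= n <= b ^ e.
Proof.
move=> e0 eB Bn.
have ex : exists b, n <= b ^ e.
  by exists n; rewrite -{1}(expn1 n) leq_pexp2l // (leq_ltn_trans _ Bn).
case: (ex_minnP ex) => b nb bmin.
have Bb : B < b by rewrite -(ltn_exp2r _ _ e0) (leq_trans Bn).
have b0 : 0 < b by apply: leq_ltn_trans Bb.
exists b; rewrite // nb andbT.
have : b.-1 ^ e < n.
  by rewrite ltnNge; apply/negP => /bmin; lia.
move=> bn; rewrite -(leq_pmul2l b0) -expnS prednK //.
apply: (@leq_trans ((2 * b.-1) ^ e)).
  apply: leq_pow2r; suff : 1 < b by lia.
  by apply: leq_ltn_trans Bb; rewrite (leq_trans _ eB) // expn_gt0.
by rewrite expnMn leq_mul // ltnW // (leq_ltn_trans eB).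
Qed.

From mathcomp Require Import all_boot all_order all_algebra.
From mathcomp Require Import all_classical all_reals all_analysis.
From mathcomp Require Import ring.

Import Order.TTheory GRing.Theory Num.Theory.
Import numFieldNormedType.Exports.
Local Open Scope classical_set_scope.
Local Open Scope ring_scope.

(** The left side is at most [b] to the power [2 * c ^ 2 * (1/2 - 1/c) = c ^ 2 - 2 * c], and
    [c + 2 <= 2 * c]. *)
Lemma powR_le_power (R : realType) (n b c : nat) (eps : R) :
  (1 < c)%N -> c%:R^-1 <= eps -> (0 < n <= b ^ (2 * c ^ 2))%N ->
  n%:R `^ (2^-1 - eps) <= (b ^ (c ^ 2 - (c + 2)))%:R.
Proof.
move=> c1 ceps /andP[n0 nb].
have c0 : c%:R != 0 :> R by rewrite pnatr_eq0; lia.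
have b0 : (0 < b)%N by have := leq_trans n0 nb; rewrite expn_gt0; lia.
apply: (@le_trans _ _ (n%:R `^ (2^-1 - c%:R^-1))).
  by rewrite ler_powR ?ler1n // lerD2l lerN2.
apply: (@le_trans _ _ ((b ^ (2 * c ^ 2))%:R `^ (2^-1 - c%:R^-1))).
  rewrite ge0_ler_powR ?nnegrE ?ler0n ?ler_nat //.
  by rewrite subr_ge0 lef_pV2 ?posrE ?ltr0n ?ler_nat //; lia.
rewrite natrX -powR_mulrn ?ler0n // -powRrM.
have -> : (2 * c ^ 2)%:R * (2^-1 - c%:R^-1) = (c ^ 2 - 2 * c)%:R :> R.
  rewrite natrB; last by nia.
  by rewrite [in LHS]natrM [in RHS]natrM natrX; field; rewrite c0.
by rewrite powR_mulrn ?ler0n // -natrX ler_nat leq_pexp2l //; lia.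
Qed.

Theorem theorem1p5 (R : realType) (r : nat) (eps : R)
    (hr : (4 <= r)%N) (heps : 0 < eps) :
  exists F : sgraph,
    subgraph_free (complete_graph r.-1) F /\
    (fun n : nat => (erdos_rogers F (complete_graph r) n)%:R : R)
      \is 'Omega_\oo (fun n : nat => (n%:R : R) `^ (2^-1 - eps)).
Proof.
have [c c1 ceps] : exists2 c : nat, (1 < c)%N & c%:R^-1 <= eps.
  exists (Num.bound eps^-1).+2; rewrite // invf_ple ?posrE ?ltr0n //.
  apply: ltW; apply: lt_le_trans (archi_boundP _) _; first by rewrite invr_ge0 ltW.
  by rewrite ler_nat leqW.
case: r hr => // -[//|q] hr.
(* [a] is just above the square root of [k], so that [k < a.-1 ^ 2] while the loss [a / (2 * k)] in
   the exponent stays at most [1 / c <= eps]. *)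
pose k := (c ^ 2)%N; pose a := (c + 2)%N; pose t := (2 * k ^ 2 + a)%N.
exists (blowup q (a + k * t)); split; first exact: blowup_clique_free.
apply/asboolP; exists 1 => //; near=> n.
rewrite mul1r !ger0_norm ?powR_ge0 //.
have [||| b Bb nb] := @between_powers (2 * k) (2 ^ (2 * k)) n => //.
- by rewrite /k; nia.
- by near: n; exact: nbhs_infty_gt.
have /andP[_ nb2] := nb.
have n0 : (0 < n)%N by near: n; exact: nbhs_infty_gt.
apply: (le_trans (@powR_le_power R n b c eps c1 ceps _)); first by rewrite n0.
rewrite ler_nat; apply: erdos_rogers_max; first exact: clique_free_graph.
have B4 : (2 ^ 2 <= 2 ^ (2 * k))%N by rewrite leq_pexp2l // /k; nia.
apply: (@forces_blowup _ _ a) => //; rewrite /a /k; nia.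
Unshelve. all: by end_near.
Qed.
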